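(* Let $a>0$ be any real number. Then there is no rotationally symmetric harmonic diffeomorphism from $\mathbb{D}^*$ onto $P(a)$, where $P(a)$ is equipped with its hyperbolic metric $\dfrac{-\pi\,|du|}{a|u|\sin\left(\frac{\pi}{a}\ln|u|\right)}$.
   Context: Let $\mathbb{D}=\{z\in\mathbb{C}:|z|<1\}$, $\mathbb{D}^*=\mathbb{D}\setminus\{0\}$, and, for $a>0$, $P(a)=\mathbb{D}\setminus\{|z|\le e^{-a}\}=\{z\in\mathbb{C}: e^{-a}<|z|<1\}$. Harmonic map: let $M$ and $N$ be oriented surfaces with metrics $\tau^2|dz|^2$ and $\sigma^2|du|^2$ respectively, where $z$ and $u$ are local complex coordinates on $M$ and $N$. A $C^2$ map $u$ from $M$ to $N$ is harmonic if and only if $$u_{z\bar z}+\frac{2\sigma_u}{\sigma}\,u_z u_{\bar z}=0,$$ where $\sigma_u$ denotes the Wirtinger derivative $\partial\sigma/\partial u$ evaluated along the map (the condition does not depend on the choice of conformal metric $\tau^2|dz|^2$ on the domain). Here the domain $\mathbb{D}^*$ has its standard complex coordinate $z$, and the target is $P(a)$ with standard complex coordinate $u$ and $\sigma(u)=\dfrac{-\pi}{a|u|\sin\left(\frac{\pi}{a}\ln|u|\right)}>0$. Rotationally symmetric: with $(r,\theta)$ the polar coordinates on the domain ($z=re^{i\theta}$), a map is rotationally symmetric if it has the form $z=re^{i\theta}\mapsto f(r)e^{i\theta}$ for some positive real-valued function $f$ of $r$. *)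

(* Defs.v *)
From Stdlib Require Export Reals.
From Coquelicot Require Export Coquelicot.
Open Scope R_scope.

Definition partial_x (u : C -> C) (z : C) : C :=
  (Derive (fun t => fst (u (t, snd z))) (fst z),
   Derive (fun t => snd (u (t, snd z))) (fst z)).

Definition partial_y (u : C -> C) (z : C) : C :=
  (Derive (fun t => fst (u (fst z, t))) (snd z),
   Derive (fun t => snd (u (fst z, t))) (snd z)).

Definition ex_partials (u : C -> C) (z : C) : Prop :=
  ex_derive (fun t => fst (u (t, snd z))) (fst z) /\
  ex_derive (fun t => snd (u (t, snd z))) (fst z) /\
  ex_derive (fun t => fst (u (fst z, t))) (snd z) /\
  ex_derive (fun t => snd (u (fst z, t))) (snd z).

(* Real C^k regularity. Maps are total functions on C of which only the
   restriction to D matters; D is meant to be open, so that the derivatives and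
   limits taken in C depend only on that restriction. *)
Fixpoint class_C (k : nat) (D : C -> Prop) (u : C -> C) : Prop :=
  match k with
  | O => forall z, D z -> continuous u z
  | S k' =>
      (forall z, D z -> continuous u z /\ ex_partials u z) /\
      class_C k' D (partial_x u) /\ class_C k' D (partial_y u)
  end.

Definition wirtinger (u : C -> C) (z : C) : C :=
  ((partial_x u z - Ci * partial_y u z) / 2)%C.

Definition wirtinger_bar (u : C -> C) (z : C) : C :=
  ((partial_x u z + Ci * partial_y u z) / 2)%C.

Definition maps_to (D N : C -> Prop) (u : C -> C) : Prop :=
  forall z, D z -> N (u z).

(* Harmonic maps between plane domains, the target N carrying the conformal
   metric sigma^2 |du|^2. *)
Definition harmonic (D N : C -> Prop) (sigma : C -> R) (u : C -> C) : Prop :=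
  maps_to D N u /\ class_C 2 D u /\
  forall z, D z ->
    (wirtinger_bar (wirtinger u) z
     + 2 * wirtinger (fun w => RtoC (sigma w)) (u z) / RtoC (sigma (u z))
       * wirtinger u z * wirtinger_bar u z)%C = RtoC 0.

(* Only C^1 regularity is asked of a diffeomorphism and of its inverse, so a
   nonexistence result for this notion covers every smoother one. *)
Definition diffeomorphism (D N : C -> Prop) (u : C -> C) : Prop :=
  maps_to D N u /\ class_C 1 D u /\
  exists v : C -> C,
    maps_to N D v /\ class_C 1 N v /\
    (forall z, D z -> v (u z) = z) /\
    (forall w, N w -> u (v w) = w).

Definition polar (r theta : R) : C := (r * cos theta, r * sin theta).

Definition rotationally_symmetric (D : C -> Prop) (u : C -> C) : Prop :=
  exists f : R -> R, forall r theta : R,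
    0 < r -> D (polar r theta) ->
    0 < f r /\ u (polar r theta) = polar (f r) theta.

Definition punctured_disc (z : C) : Prop := Cmod z < 1 /\ z <> RtoC 0.

Definition annulus (a : R) (z : C) : Prop := exp (- a) < Cmod z < 1.

Definition annulus_density (a : R) (w : C) : R :=
  - PI / (a * Cmod w * sin (PI / a * ln (Cmod w))).

(* Main.v *)
Require Import Defs.
From Stdlib Require Import Lra Psatz.

(** Why no such map exists.  A rotationally symmetric map is determined by its
    radial profile F, and in the logarithmic coordinates t = ln r on the domain
    and g = ln F on the target the domain becomes the half-infinite cylinder
    t < 0, while the target becomes the finite cylinder - a < g < 0 with the
    metric rho (g) |dw|, rho (x) = - PI / (a sin (PI x / a)).  Harmonicity
    becomes the autonomous equation
    [g'' = (PI / a) cot (PI g / a) (g'^2 - 1)]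
    (lemmas [tension_rotational] and [profile_ODE]), and the Hopf differential
    provides the conserved quantity [c = (g'^2 - 1) / sin^2 (PI g / a)]
    ([first_integral]).

    A map onto the annulus hits the core circle g = - a / 2, where the sine is
    - 1 and thus g'^2 = 1 + c; since the map has a differentiable inverse, g'
    does not vanish there ([profile_immersed]), so 1 + c > 0.  Everywhere else
    g'^2 = 1 + c sin^2 (PI g / a) lies between 1 and 1 + c, hence |g'| is
    bounded below by a positive constant.  By the mean value theorem g is then
    unbounded on the half-line t < 0, which contradicts - a < g < 0
    ([bounded_solution_rests_at_middle]). *)

(** * The equation of the logarithmic profile *)

Lemma sin_strip_neg : forall a x, 0 < a -> - a < x < 0 -> sin (PI / a * x) < 0.
Proof.
  intros a x Ha Hx.
  assert (Hk : 0 < PI / a) by (apply Rdiv_lt_0_compat; [exact PI_RGT_0 | exact Ha]).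
  assert (E : PI / a * a = PI) by (field; lra).
  apply sin_lt_0_var; nra.
Qed.

Lemma is_derive_zero_const : forall f t s,
  (forall x, x < 0 -> is_derive f x 0) -> t < 0 -> s < 0 -> f t = f s.
Proof.
  intros f t s Hf Ht Hs.
  destruct (MVT_gen f s t (fun _ => 0)) as [c [_ Hc]].
  - intros x Hx; apply Hf.
    apply Rlt_le_trans with (1 := proj2 Hx). apply Rmax_lub; lra.
  - intros x Hx; apply continuity_pt_filterlim.
    apply (ex_derive_continuous f x); exists 0; apply Hf.
    apply Rle_lt_trans with (1 := proj2 Hx). apply Rmax_lub_lt; lra.
  - lra.
Qed.

(** The Hopf differential of the map is holomorphic; for a rotationally
    symmetric map it is, up to a factor, this quantity times [dz^2 / z^2], so the
    quantity is constant.  Concretely, the equation is what makes the two terms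
    of the quotient rule cancel. *)
Lemma first_integral : forall (a : R) (g g1 : R -> R),
  0 < a ->
  (forall t, t < 0 -> - a < g t < 0) ->
  (forall t, t < 0 -> is_derive g t (g1 t)) ->
  (forall t, t < 0 ->
    is_derive g1 t
      (PI / a * cos (PI / a * g t) / sin (PI / a * g t) * (g1 t ^ 2 - 1))) ->
  forall t s, t < 0 -> s < 0 ->
  (g1 t ^ 2 - 1) / sin (PI / a * g t) ^ 2
  = (g1 s ^ 2 - 1) / sin (PI / a * g s) ^ 2.
Proof.
  intros a g g1 Ha range Dg Dg1 t s Ht Hs.
  apply (is_derive_zero_const
           (fun t => (g1 t ^ 2 - 1) / sin (PI / a * g t) ^ 2)); try assumption.
  intros x Hx.
  pose proof (sin_strip_neg a (g x) Ha (range x Hx)) as Hsin.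
  pose proof (Dg x Hx) as D0. pose proof (Dg1 x Hx) as D1.
  auto_derive.
  - repeat split; [eexists; exact D1 | eexists; exact D0 | simpl; nra].
  - replace (Derive (fun x => g x) x) with (g1 x)
      by (symmetry; exact (is_derive_unique _ _ _ D0)).
    replace (Derive (fun x => g1 x) x) with
      (PI / a * cos (PI / a * g x) / sin (PI / a * g x) * (g1 x ^ 2 - 1))
      by (symmetry; exact (is_derive_unique _ _ _ D1)).
    field. simpl. repeat split; lra.
Qed.

(** The middle of the strip is where [sin ^ 2] is largest, whereas at its ends
    [sin ^ 2] vanishes and the first integral would force [g1 ^ 2 = 1].  A nonzero
    velocity at the middle therefore bounds the speed below at all times, and a
    function with such speed on a half-line leaves every bounded interval. *)
Lemma bounded_solution_rests_at_middle : forall (a : R) (g g1 : R -> R),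
  0 < a ->
  (forall t, t < 0 -> - a < g t < 0) ->
  (forall t, t < 0 -> is_derive g t (g1 t)) ->
  (forall t, t < 0 ->
    is_derive g1 t
      (PI / a * cos (PI / a * g t) / sin (PI / a * g t) * (g1 t ^ 2 - 1))) ->
  forall t0,
  t0 < 0 -> g t0 = - a / 2 -> g1 t0 = 0.
Proof.
  intros a g g1 Ha range Dg Dg1 t0 Ht0 Hmid.
  destruct (Req_dec (g1 t0) 0) as [H0 | Hne]; [exact H0 | exfalso].
  (* [g1 ^ 2] is a convex combination of 1 and [g1 t0 ^ 2], with weight
     [sin ^ 2] on the latter. *)
  set (m := Rmin 1 (g1 t0 ^ 2)).
  assert (Hm : 0 < m).
  { unfold m; apply Rmin_glb_lt; [lra | nra]. }
  assert (Hslope : forall t, t < 0 -> m <= g1 t ^ 2).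
  { intros t Ht.
    pose proof (first_integral a g g1 Ha range Dg Dg1 t t0 Ht Ht0) as E.
    pose proof (sin_strip_neg a (g t) Ha (range t Ht)) as Hs.
    pose proof (SIN_bound (PI / a * g t)) as Hb.
    replace (sin (PI / a * g t0)) with (-1) in E.
    2:{ rewrite Hmid. replace (PI / a * (- a / 2)) with (- (PI / 2)) by (field; lra).
        rewrite sin_neg, sin_PI2; reflexivity. }
    set (q := sin (PI / a * g t)) in *.
    assert (E' : g1 t ^ 2 = 1 - q ^ 2 + g1 t0 ^ 2 * q ^ 2).
    { replace (g1 t ^ 2) with ((g1 t ^ 2 - 1) / q ^ 2 * q ^ 2 + 1) by (field; lra).
      rewrite E. field. }
    rewrite E'.
    assert (0 <= q ^ 2 <= 1) by nra.
    assert (m <= 1) by apply Rmin_l. assert (m <= g1 t0 ^ 2) by apply Rmin_r.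
    nra. }
  (* A time span long enough for a speed of [sqrt m] to cover more than [a]:
     [m T^2 > m (a / m + a)^2 >= 2 a^2 > a^2] by the cross term. *)
  set (T := a / m + a + 1).
  assert (Hq : a / m * m = a) by (field; lra).
  assert (Hq0 : 0 < a / m) by (apply Rdiv_lt_0_compat; lra).
  destruct (MVT_gen g (-1 - T) (-1) g1) as [c [Hc E]].
  - intros x [_ Hx]. apply Dg.
    apply Rlt_le_trans with (1 := Hx). apply Rmax_lub; unfold T; lra.
  - intros x [_ Hx]. apply continuity_pt_filterlim.
    apply (ex_derive_continuous g x). exists (g1 x). apply Dg.
    apply Rle_lt_trans with (1 := Hx). apply Rmax_lub_lt; unfold T; lra.
  - assert (Hc0 : c < 0).
    { apply Rle_lt_trans with (1 := proj2 Hc). apply Rmax_lub_lt; unfold T; lra. }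
    pose proof (Hslope c Hc0) as Hsl.
    pose proof (range (-1) ltac:(lra)) as R1.
    pose proof (range (-1 - T) ltac:(unfold T; lra)) as R2.
    replace (-1 - (-1 - T)) with T in E by ring.
    assert (B : (g1 c * T) ^ 2 <= a ^ 2) by (rewrite <- E; nra).
    assert (T2 : a * a < m * (T * T)).
    { unfold T. set (b := a / m) in *. nra. }
    assert (m * (T * T) <= g1 c ^ 2 * (T * T)) by (apply Rmult_le_compat_r; nra).
    nra.
Qed.

(** * Wirtinger derivatives of radial expressions *)

(** Relational form of the partial derivatives: unlike [Derive], it carries the
    existence of the derivatives, so it composes and can be transported along
    local equalities. *)
Definition has_partials (u : C -> C) (z ux uy : C) : Prop :=
  is_derive (fun t : R => fst (u (t, snd z))) (fst z) (fst ux) /\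
  is_derive (fun t : R => snd (u (t, snd z))) (fst z) (snd ux) /\
  is_derive (fun t : R => fst (u (fst z, t))) (snd z) (fst uy) /\
  is_derive (fun t : R => snd (u (fst z, t))) (snd z) (snd uy).

(* [repeat split] would unfold [is_derive] itself. *)
Ltac split_partials := split; [| split; [| split]].

Lemma locally_slices : forall (P : C -> Prop) z, locally z P ->
  locally (fst z) (fun t => P (t, snd z)) /\
  locally (snd z) (fun t => P (fst z, t)).
Proof.
  intros P [x y] [e He]; simpl; split; exists e; intros t Ht;
    apply He; split; simpl; try exact Ht; apply ball_center.
Qed.

Lemma has_partials_ext_loc : forall u v z ux uy,
  locally z (fun w => v w = u w) -> has_partials v z ux uy ->
  has_partials u z ux uy.
Proof.
  intros u v z ux uy H [H1 [H2 [H3 H4]]].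
  destruct (locally_slices _ _ H) as [Hx Hy].
  split_partials; (eapply is_derive_ext_loc; [| eassumption]);
    ((eapply filter_imp; [| exact Hx]) || (eapply filter_imp; [| exact Hy]));
    intros t Ht; simpl in Ht |- *; rewrite Ht; reflexivity.
Qed.

Lemma wirtinger_has_partials : forall u z ux uy, has_partials u z ux uy ->
  wirtinger u z = ((fst ux + snd uy) / 2, (snd ux - fst uy) / 2) /\
  wirtinger_bar u z = ((fst ux - snd uy) / 2, (snd ux + fst uy) / 2).
Proof.
  intros u z ux uy [H1 [H2 [H3 H4]]].
  unfold wirtinger, wirtinger_bar, partial_x, partial_y.
  rewrite (is_derive_unique _ _ _ H1), (is_derive_unique _ _ _ H2),
    (is_derive_unique _ _ _ H3), (is_derive_unique _ _ _ H4).
  split; unfold Cdiv, Cminus, Cplus, Copp, Cmult, Cinv, Ci, RtoC; simpl;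
    f_equal; field.
Qed.

Lemma is_derive_Cmod : forall z : C, z <> RtoC 0 ->
  is_derive (fun t => Cmod (t, snd z)) (fst z) (fst z / Cmod z) /\
  is_derive (fun t => Cmod (fst z, t)) (snd z) (snd z / Cmod z).
Proof.
  intros [x y] Hz. apply Cmod_gt_0 in Hz. unfold Cmod in *. simpl in *.
  assert (H : 0 < x * (x * 1) + y * (y * 1)).
  { destruct (Rle_or_lt (x * (x * 1) + y * (y * 1)) 0) as [H | H]; [| exact H].
    rewrite sqrt_neg_0 in Hz by exact H. lra. }
  split; auto_derive; try exact H; field; lra.
Qed.

Lemma has_partials_radial : forall (p : R -> R) z d, z <> RtoC 0 ->
  is_derive p (Cmod z) d ->
  has_partials (fun w => RtoC (p (Cmod w))) z
    (RtoC (d * fst z / Cmod z)) (RtoC (d * snd z / Cmod z)).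
Proof.
  intros p [x y] d Hz Hp.
  destruct (is_derive_Cmod _ Hz) as [Hx Hy]. apply Cmod_gt_0 in Hz.
  split_partials; simpl in *.
  - replace (d * x / Cmod (x, y)) with (x / Cmod (x, y) * d) by (field; lra).
    exact (is_derive_comp p (fun t => Cmod (t, y)) x _ _ Hp Hx).
  - apply (is_derive_const (V := R_NormedModule) 0).
  - replace (d * y / Cmod (x, y)) with (y / Cmod (x, y) * d) by (field; lra).
    exact (is_derive_comp p (fun t => Cmod (x, t)) y _ _ Hp Hy).
  - apply (is_derive_const (V := R_NormedModule) 0).
Qed.

(* The equations left by the derivation rules are typed in the carrier of a
   normed module, where [ring] does not see the field of reals. *)
Ltac real_ring := unfold one, zero; simpl;
  match goal with |- ?l = ?r => change (@eq R l r) end; ring.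

Lemma is_derive_Rmult : forall (f g : R -> R) x df dg l,
  is_derive f x df -> is_derive g x dg -> l = df * g x + f x * dg ->
  is_derive (fun t => f t * g t) x l.
Proof.
  intros f g x df dg l Hf Hg ->.
  apply (is_derive_mult f g x df dg Hf Hg). intros; apply Rmult_comm.
Qed.

Lemma has_partials_radial_multiple : forall (q : R -> R) z d, z <> RtoC 0 ->
  is_derive q (Cmod z) d ->
  has_partials (fun w => (RtoC (q (Cmod w)) * w)%C) z
    (d * fst z / Cmod z * fst z + q (Cmod z), d * fst z / Cmod z * snd z)
    (d * snd z / Cmod z * fst z, d * snd z / Cmod z * snd z + q (Cmod z)).
Proof.
  intros q z d Hz Hq.
  destruct (has_partials_radial q z d Hz Hq) as [Hx [_ [Hy _]]].
  destruct z as [x y]; simpl in *.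
  split_partials; simpl.
  - apply is_derive_ext with (fun t => q (Cmod (t, y)) * t); [intros; real_ring |].
    eapply is_derive_Rmult; [exact Hx | apply @is_derive_id | real_ring].
  - apply is_derive_ext with (fun t => q (Cmod (t, y)) * y); [intros; real_ring |].
    eapply is_derive_Rmult; [exact Hx | apply @is_derive_const | real_ring].
  - apply is_derive_ext with (fun t => q (Cmod (x, t)) * x); [intros; real_ring |].
    eapply is_derive_Rmult; [exact Hy | apply @is_derive_const | real_ring].
  - apply is_derive_ext with (fun t => q (Cmod (x, t)) * t); [intros; real_ring |].
    eapply is_derive_Rmult; [exact Hy | apply @is_derive_id | real_ring].
Qed.

Lemma Cmod_sqr : forall z : C, Cmod z * Cmod z = fst z * fst z + snd z * snd z.
Proof.
  intros z. unfold Cmod. rewrite sqrt_sqrt; [ring |].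
  nra.
Qed.

(** The chain rule for the modulus, whose own derivatives are
    [conj z / (2 |z|)] and [z / (2 |z|)]. *)
Lemma wirtinger_radial : forall (p : R -> R) u z d, z <> RtoC 0 ->
  locally z (fun w => u w = RtoC (p (Cmod w))) -> is_derive p (Cmod z) d ->
  wirtinger u z = (RtoC (d / (2 * Cmod z)) * Cconj z)%C /\
  wirtinger_bar u z = (RtoC (d / (2 * Cmod z)) * z)%C.
Proof.
  intros p u z d Hz Hu Hp.
  destruct (wirtinger_has_partials u z _ _
    (has_partials_ext_loc _ _ _ _ _
      (filter_imp _ _ (fun w (E : u w = _) => eq_sym E) Hu)
      (has_partials_radial p z d Hz Hp))) as [-> ->].
  apply Cmod_gt_0 in Hz.
  destruct z as [x y]; unfold Cmult, Cconj, RtoC; simpl.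
  split; f_equal; field; lra.
Qed.

(** The product rule for [q (|z|) z]: as [z] is holomorphic, its own
    derivative enters [wirtinger] only; the other term there has the factor
    [conj z * z = |z|^2], so no phase remains. *)
Lemma wirtinger_radial_multiple : forall (q : R -> R) u z d, z <> RtoC 0 ->
  locally z (fun w => u w = (RtoC (q (Cmod w)) * w)%C) ->
  is_derive q (Cmod z) d ->
  wirtinger u z = RtoC (Cmod z * d / 2 + q (Cmod z)) /\
  wirtinger_bar u z = (RtoC (d / (2 * Cmod z)) * (z * z))%C.
Proof.
  intros q u z d Hz Hu Hq.
  destruct (wirtinger_has_partials u z _ _
    (has_partials_ext_loc _ _ _ _ _
      (filter_imp _ _ (fun w (E : u w = _) => eq_sym E) Hu)
      (has_partials_radial_multiple q z d Hz Hq))) as [-> ->].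
  apply Cmod_gt_0 in Hz. pose proof (Cmod_sqr z) as E.
  destruct z as [x y]; unfold Cmult, RtoC; simpl in *.
  split; f_equal; try (field; lra).
  replace (Cmod (x, y) * d / 2) with
    ((Cmod (x, y) * Cmod (x, y)) * d / (2 * Cmod (x, y))) by (field; lra).
  rewrite E. field. lra.
Qed.

Lemma polar_form : forall z : C, exists theta, z = polar (Cmod z) theta.
Proof.
  intros z. destruct (Req_dec (Cmod z) 0) as [H0 | H0].
  { exists 0. apply Cmod_eq_0 in H0. subst z. unfold polar. rewrite Cmod_0.
    unfold RtoC. f_equal; ring. }
  pose proof (Cmod_ge_0 z) as Hp. pose proof (Cmod_sqr z) as E.
  destruct z as [x y]; simpl in *.
  set (r := Cmod (x, y)) in *.
  assert (Hb : -1 <= x / r <= 1).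
  { split; [apply Rle_div_r | apply Rle_div_l]; nra. }
  assert (Es : sqrt (1 - (x / r)²) = Rabs (y / r)).
  { rewrite <- sqrt_Rsqr_abs. f_equal. unfold Rsqr.
    replace 1 with (r * r / (r * r)) by (field; lra). rewrite E at 1.
    field. lra. }
  pose proof (cos_acos _ Hb) as Ec. pose proof (sin_acos _ Hb) as Esin.
  rewrite Es in Esin.
  destruct (Rle_or_lt 0 (y / r)) as [Hy | Hy].
  - exists (acos (x / r)). unfold polar. rewrite Ec, Esin, Rabs_pos_eq by exact Hy.
    f_equal; field; lra.
  - exists (- acos (x / r)). unfold polar.
    rewrite cos_neg, sin_neg, Ec, Esin, Rabs_left by exact Hy.
    f_equal; field; lra.
Qed.

Lemma Cmod_polar : forall r theta, 0 <= r -> Cmod (polar r theta) = r.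
Proof.
  intros r theta Hr. unfold Cmod, polar; simpl.
  replace (_ + _) with (r ^ 2 * (Rsqr (sin theta) + Rsqr (cos theta)))
    by (unfold Rsqr; ring).
  rewrite sin2_cos2, Rmult_1_r. apply sqrt_pow2, Hr.
Qed.

(** The norm is taken for the real product structure on [C], since that is the
    topology in which [locally] is understood. *)
Lemma filterlim_Cmod : forall w : C,
  filterlim Cmod (locally w) (locally (Cmod w)).
Proof.
  intros w. rewrite Cmod_norm.
  apply (@filterlim_ext C R (locally w) _
    (@filter_filter _ _ (@locally_filter C_UniformSpace w))
    (fun x => @norm R_AbsRing
       (prod_NormedModule _ R_NormedModule R_NormedModule) x)).
  - intros x; symmetry; apply Cmod_norm.
  - exact (@filterlim_norm R_AbsRing
      (prod_NormedModule _ R_NormedModule R_NormedModule) w).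
Qed.

Lemma open_punctured_disc : open punctured_disc.
Proof.
  apply open_ext with (fun z : C => Cmod z < 1 /\ 0 < Cmod z).
  { intros z. unfold punctured_disc. rewrite Cmod_gt_0. tauto. }
  apply open_and.
  - apply (@open_comp C_UniformSpace R_UniformSpace Cmod (fun x => x < 1));
      [intros; apply filterlim_Cmod | apply open_lt].
  - apply (@open_comp C_UniformSpace R_UniformSpace Cmod (fun x => 0 < x));
      [intros; apply filterlim_Cmod | apply open_gt].
Qed.

(** * The harmonic map equation under rotational symmetry *)

(** By rotational symmetry it suffices to evaluate the equation on the positive
    real axis, where all terms are real.  The derivative [u_z] is
    [(F' + F / r) / 2], radial again, so differentiating it once more needs only
    the formula for radial functions; and [u_zbar] is [(F' - F / r) / 2].  Any
    radial target density [s] is allowed. *)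
Lemma tension_rotational :
  forall (u : C -> C) (s F F1 : R -> R) (r F2 s1 : R), 0 < r -> 0 < F r ->
  locally (RtoC r) (fun w => u w = (RtoC (F (Cmod w) / Cmod w) * w)%C) ->
  locally r (fun t => is_derive F t (F1 t)) ->
  is_derive F1 r F2 -> is_derive s (F r) s1 -> s (F r) <> 0 ->
  (wirtinger_bar (wirtinger u) (RtoC r)
   + 2 * wirtinger (fun w => RtoC (s (Cmod w))) (u (RtoC r))
       / RtoC (s (Cmod (u (RtoC r))))
     * wirtinger u (RtoC r) * wirtinger_bar u (RtoC r))%C
  = RtoC ((F2 + F1 r / r - F r / r ^ 2
           + s1 / s (F r) * (F1 r ^ 2 - F r ^ 2 / r ^ 2)) / 4).
Proof.
  intros u s F F1 r F2 s1 Hr HF Hu HF1 HF2 Hs Hs0.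
  assert (Er : Cmod (RtoC r) = r) by (rewrite Cmod_R; apply Rabs_pos_eq; lra).
  assert (Hz : RtoC r <> RtoC 0) by (intros E; apply RtoC_inj in E; lra).
  assert (Eu : u (RtoC r) = RtoC (F r)).
  { rewrite (locally_singleton _ _ Hu), Er, <- RtoC_mult. f_equal. field. lra. }
  assert (Hq : forall t, 0 < t -> is_derive F t (F1 t) ->
    is_derive (fun t => F t / t) t (F1 t / t - F t / t ^ 2)).
  { intros t Ht HD. auto_derive.
    - repeat split; [eexists; exact HD | lra].
    - replace (Derive (fun x => F x) t) with (F1 t)
        by (symmetry; exact (is_derive_unique _ _ _ HD)).
      field. lra. }
  assert (Hpos : locally r (fun t => 0 < t)) by (apply (open_gt 0), Hr).
  (* The derivative u_z is again radial, and without a phase. *)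
  assert (Hw : locally (RtoC r) (fun w =>
    wirtinger u w = RtoC ((F1 (Cmod w) + F (Cmod w) / Cmod w) / 2))).
  { pose proof (filterlim_Cmod (RtoC r)) as HC. rewrite Er in HC.
    pose proof (HC _ HF1) as A1. pose proof (HC _ Hpos) as A2.
    unfold filtermap in A1, A2.
    apply (filter_imp (fun w => is_derive F (Cmod w) (F1 (Cmod w)) /\ 0 < Cmod w /\
       locally w (fun w => u w = (RtoC (F (Cmod w) / Cmod w) * w)%C))).
    - intros w [B1 [B2 B3]].
      destruct (wirtinger_radial_multiple (fun t => F t / t) u w _
        (proj2 (Cmod_gt_0 w) B2) B3 (Hq _ B2 B1)) as [E _].
      rewrite E. f_equal. field. lra.
    - apply filter_and; [exact A1 | apply filter_and; [exact A2 |]].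
      apply locally_locally, Hu. }
  destruct (wirtinger_radial (fun t => (F1 t + F t / t) / 2) (wirtinger u)
    (RtoC r) ((F2 + F1 r / r - F r / r ^ 2) / 2) Hz Hw) as [_ E1].
  { rewrite Er. pose proof (locally_singleton _ _ HF1) as D1.
    auto_derive.
    - repeat split; [eexists; exact HF2 | eexists; exact D1 | lra].
    - replace (Derive (fun x => F x) r) with (F1 r)
        by (symmetry; exact (is_derive_unique _ _ _ D1)).
      replace (Derive (fun x => F1 x) r) with F2
        by (symmetry; exact (is_derive_unique _ _ _ HF2)).
      field. lra. }
  destruct (wirtinger_radial_multiple (fun t => F t / t) u (RtoC r)
    (F1 r / r - F r / r ^ 2) Hz Hu) as [_ E2].
  { rewrite Er. apply Hq; [exact Hr | exact (locally_singleton _ _ HF1)]. }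
  assert (Hz' : u (RtoC r) <> RtoC 0).
  { rewrite Eu. intros E. apply RtoC_inj in E. lra. }
  assert (EF : Cmod (u (RtoC r)) = F r).
  { rewrite Eu, Cmod_R. apply Rabs_pos_eq. lra. }
  destruct (wirtinger_radial s (fun w : C => RtoC (s (Cmod w))) (u (RtoC r)) s1 Hz')
    as [E3 _].
  { apply filter_forall. reflexivity. }
  { rewrite EF. exact Hs. }
  rewrite E1, E2, E3, (locally_singleton _ _ Hw), EF, Eu, Er.
  unfold Cdiv, Cplus, Cmult, Cinv, Cconj, RtoC; simpl.
  f_equal; field; lra.
Qed.

(** * Rotationally symmetric maps from the punctured disc to the annulus *)

Lemma is_derive_annulus_density : forall a x, 0 < a -> 0 < x ->
  - a < ln x < 0 ->
  is_derive (fun x => - PI / (a * x * sin (PI / a * ln x))) x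
    (- PI / (a * x * sin (PI / a * ln x)) *
     (- (1 + PI / a * cos (PI / a * ln x) / sin (PI / a * ln x)) / x)).
Proof.
  intros a x Ha Hx Hl. pose proof (sin_strip_neg a (ln x) Ha Hl) as Hs.
  auto_derive.
  - repeat split; try lra. 
    apply Rmult_integral_contrapositive_currified; [nra | lra].
  - field. repeat split; lra.
Qed.

Lemma locally_unit_interval : forall (r : R), 0 < r < 1 ->
  locally r (fun t => 0 < t < 1).
Proof.
  intros r Hr. apply filter_and; [apply (open_gt 0) | apply (open_lt 1)]; lra.
Qed.

Lemma RtoC_punctured_disc : forall t, 0 < t < 1 -> punctured_disc (RtoC t).
Proof.
  intros t Ht. split.
  - rewrite Cmod_R, Rabs_pos_eq; lra.
  - intros E. apply RtoC_inj in E. lra.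
Qed.

Lemma annulus_ln : forall a w, 0 < Cmod w -> annulus a w -> - a < ln (Cmod w) < 0.
Proof.
  intros a w H0 [H1 H2]. split.
  - rewrite <- (ln_exp (- a)). apply ln_increasing; [apply exp_pos | exact H1].
  - rewrite <- ln_1. apply ln_increasing; lra.
Qed.

(** For a rotationally symmetric map this is the radial function [f], recovered
    from [u] so that its regularity can be read off from that of [u]. *)
Definition profile (u : C -> C) (t : R) : R := fst (u (RtoC t)).

Lemma rotational_formula : forall u,
  rotationally_symmetric punctured_disc u ->
  forall w, punctured_disc w ->
    0 < profile u (Cmod w) /\ Cmod (u w) = profile u (Cmod w) /\
    u w = (RtoC (profile u (Cmod w) / Cmod w) * w)%C.
Proof.
  intros u [f Hf] w Hw.
  assert (H0 : 0 < Cmod w) by (apply Cmod_gt_0, Hw).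
  assert (P0 : RtoC (Cmod w) = polar (Cmod w) 0).
  { unfold polar, RtoC. rewrite cos_0, sin_0. f_equal; ring. }
  assert (EF : profile u (Cmod w) = f (Cmod w)).
  { unfold profile. rewrite P0. destruct (Hf (Cmod w) 0 H0) as [_ E].
    - rewrite <- P0. apply RtoC_punctured_disc. split; [exact H0 | apply Hw].
    - rewrite E. simpl. rewrite cos_0. ring. }
  destruct (polar_form w) as [theta Ew].
  destruct (Hf (Cmod w) theta H0) as [Hp E]; [rewrite <- Ew; exact Hw |].
  rewrite <- Ew in E. rewrite EF. split; [exact Hp | split].
  - rewrite E. apply Cmod_polar. lra.
  - rewrite E. set (r := Cmod w) in *. rewrite Ew. unfold polar, Cmult, RtoC; simpl.
    f_equal; field; lra.
Qed.

(** In the variables [t = ln r] and [g = ln (F r)] this is the autonomous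
    equation of the logarithmic profile.  The summand 1 beside the cotangent
    comes from the factor [1 / |w|] of the density; it disappears in these
    variables. *)
Lemma profile_ODE : forall a u, 0 < a ->
  rotationally_symmetric punctured_disc u ->
  harmonic punctured_disc (annulus a) (annulus_density a) u ->
  forall r, 0 < r < 1 ->
  let F := profile u in
  - a < ln (F r) < 0 /\ is_derive F r (Derive F r) /\
  is_derive (Derive F) r
    (F r / r ^ 2 - Derive F r / r
     + (1 + PI / a * cos (PI / a * ln (F r)) / sin (PI / a * ln (F r))) / F r
       * (Derive F r ^ 2 - F r ^ 2 / r ^ 2)).
Proof.
  intros a u Ha Hrot [Hmaps [[Hu [[Hux _] _]] Heq]] r Hr F.
  assert (HD : forall t, 0 < t < 1 -> is_derive F t (Derive F t)).
  { intros t Ht. apply Derive_correct.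
    exact (proj1 (proj2 (Hu (RtoC t) (RtoC_punctured_disc t Ht)))). }
  assert (HD2 : is_derive (Derive F) r (Derive (Derive F) r)).
  { apply Derive_correct.
    exact (proj1 (proj2 (Hux (RtoC r) (RtoC_punctured_disc r Hr)))). }
  pose proof (RtoC_punctured_disc r Hr) as Hz.
  destruct (rotational_formula u Hrot _ Hz) as [HF [Em _]].
  assert (Er : Cmod (RtoC r) = r) by (rewrite Cmod_R; apply Rabs_pos_eq; lra).
  rewrite Er in HF, Em. fold F in HF, Em.
  assert (Hln : - a < ln (F r) < 0).
  { rewrite <- Em. apply annulus_ln; [rewrite Em; exact HF | exact (Hmaps _ Hz)]. }
  pose proof (sin_strip_neg a (ln (F r)) Ha Hln) as Hs.
  split; [exact Hln | split; [exact (HD r Hr) |]].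
  set (s := fun x => - PI / (a * x * sin (PI / a * ln x))).
  pose proof PI_RGT_0 as HPI.
  assert (Hs0 : s (F r) <> 0).
  { unfold s. apply Rmult_integral_contrapositive_currified; [lra |].
    apply Rinv_neq_0_compat. apply Rmult_integral_contrapositive_currified; [nra | lra]. }
  pose proof (tension_rotational u s F (Derive F) r _ _ (proj1 Hr) HF
    (filter_imp _ _ (fun w Hw => proj2 (proj2 (rotational_formula u Hrot w Hw)))
       (open_punctured_disc _ Hz))
    (filter_imp _ _ HD (locally_unit_interval r Hr)) HD2
    (is_derive_annulus_density a (F r) Ha HF Hln) Hs0) as E.
  pose proof (Heq _ Hz) as E'.
  unfold annulus_density in E'. unfold s in E. rewrite E in E'. clear E.
  apply RtoC_inj in E'. fold (s (F r)) in E'.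
  assert (E2 : Derive (Derive F) r = F r / r ^ 2 - Derive F r / r
     + (1 + PI / a * cos (PI / a * ln (F r)) / sin (PI / a * ln (F r))) / F r
       * (Derive F r ^ 2 - F r ^ 2 / r ^ 2)).
  { replace (s (F r) * (- (1 + PI / a * cos (PI / a * ln (F r)) / sin (PI / a * ln (F r))) / F r) / s (F r))
      with (- (1 + PI / a * cos (PI / a * ln (F r)) / sin (PI / a * ln (F r))) / F r)
      in E' by (field; repeat split; lra).
    lra. }
  rewrite <- E2. exact HD2.
Qed.

(** On the positive real axis the inverse [v] of [u] inverts the profile, so the
    chain rule in one variable gives [v' F' = 1]. *)
Lemma profile_immersed : forall a u,
  rotationally_symmetric punctured_disc u ->
  diffeomorphism punctured_disc (annulus a) u ->
  forall r, 0 < r < 1 -> Derive (profile u) r <> 0.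
Proof.
  intros a u Hrot [Hmaps [[Hu _] [v [_ [[Hv _] [Hvu _]]]]]] r Hr H0.
  set (F := profile u) in *.
  assert (EF : forall t, 0 < t < 1 -> u (RtoC t) = RtoC (F t)).
  { intros t Ht.
    destruct (rotational_formula u Hrot _ (RtoC_punctured_disc t Ht)) as [_ [_ E]].
    rewrite E, Cmod_R, Rabs_pos_eq, <- RtoC_mult by lra.
    fold F. f_equal. field. lra. }
  pose proof (RtoC_punctured_disc r Hr) as Hz.
  assert (HD : is_derive F r 0).
  { rewrite <- H0. apply Derive_correct. exact (proj1 (proj2 (Hu _ Hz))). }
  destruct (Hv (u (RtoC r)) (Hmaps _ Hz)) as [_ [Hg _]].
  rewrite (EF r Hr) in Hg. apply Derive_correct in Hg. simpl in Hg.
  pose proof (is_derive_comp (fun t : R => fst (v (t, 0))) F r _ _ Hg HD) as Hc.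
  apply (is_derive_ext_loc _ (fun t => t)) in Hc.
  - apply is_derive_unique in Hc. rewrite Derive_id in Hc.
    unfold scal in Hc; simpl in Hc; unfold mult in Hc; simpl in Hc. lra.
  - apply (filter_imp (fun t => 0 < t < 1)); [| exact (locally_unit_interval r Hr)].
    intros t Ht. change (F t, 0) with (RtoC (F t)).
    rewrite <- (EF t Ht), (Hvu _ (RtoC_punctured_disc t Ht)). reflexivity.
Qed.

Theorem theorem1p1 : forall a : R, 0 < a ->
  ~ exists u : C -> C,
      rotationally_symmetric punctured_disc u /\
      harmonic punctured_disc (annulus a) (annulus_density a) u /\
      diffeomorphism punctured_disc (annulus a) u.
Proof.
  intros a Ha [u [Hrot [Hharm Hdiff]]].
  set (F := profile u).
  assert (Hexp : forall t, t < 0 -> 0 < exp t < 1).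
  { intros t Ht. split; [apply exp_pos |]. rewrite <- exp_0. apply exp_increasing, Ht. }
  assert (HFpos : forall r, 0 < r < 1 -> 0 < F r).
  { intros r Hr. pose proof (RtoC_punctured_disc r Hr) as Hz.
    destruct (rotational_formula u Hrot _ Hz) as [H _].
    rewrite Cmod_R, Rabs_pos_eq in H by lra. exact H. }
  pose proof (profile_ODE a u Ha Hrot Hharm) as Hode. cbv zeta in Hode. fold F in Hode.
  (* The core circle of the annulus, where the logarithmic profile is [- a / 2]. *)
  assert (Hmid : exists r0, 0 < r0 < 1 /\ F r0 = exp (- a / 2)).
  { destruct Hdiff as [_ [_ [v [Hv [_ [_ Huv]]]]]].
    set (w := RtoC (exp (- a / 2))).
    assert (Ew : Cmod w = exp (- a / 2)).
    { unfold w. rewrite Cmod_R. apply Rabs_pos_eq, Rlt_le, exp_pos. }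
    assert (Hw : annulus a w).
    { unfold annulus. rewrite Ew. split; [apply exp_increasing; lra |].
      rewrite <- exp_0. apply exp_increasing; lra. }
    pose proof (Hv w Hw) as Hz. exists (Cmod (v w)). split.
    - split; [apply Cmod_gt_0, Hz | apply Hz].
    - destruct (rotational_formula u Hrot _ Hz) as [_ [E _]].
      unfold F. rewrite <- E, (Huv w Hw). exact Ew. }
  destruct Hmid as [r0 [Hr0 E0]].
  assert (Hlog : ln r0 < 0) by (rewrite <- ln_1; apply ln_increasing; lra).
  assert (Hslope : exp (ln r0) * Derive F (exp (ln r0)) / F (exp (ln r0)) = 0).
  { apply (bounded_solution_rests_at_middle a (fun t => ln (F (exp t)))
      (fun t => exp t * Derive F (exp t) / F (exp t))); [exact Ha | | | | exact Hlog |].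
    - intros t Ht. apply Hode, Hexp, Ht.
    - intros t Ht. destruct (Hode _ (Hexp t Ht)) as [_ [D1 _]].
      pose proof (HFpos _ (Hexp t Ht)) as HF.
      auto_derive.
      + repeat split; [eexists; exact D1 | exact HF].
      + change (Derive (fun x => F x)) with (Derive F). field. lra.
    - intros t Ht. destruct (Hode _ (Hexp t Ht)) as [Hl [D1 D2]].
      pose proof (HFpos _ (Hexp t Ht)) as HF. pose proof (exp_pos t) as He.
      pose proof (sin_strip_neg a _ Ha Hl) as Hs.
      auto_derive.
      + repeat split; [eexists; exact D2 | eexists; exact D1 | lra].
      + change (Derive (fun x => F x)) with (Derive F).
        match goal with |- context [Derive (fun x => Derive ?G x) ?y] =>
          change (Derive (fun x => Derive G x) y) with (Derive (Derive F) y) end.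
        rewrite (is_derive_unique _ _ _ D2).
        field. repeat split; lra.
    - cbv beta. rewrite exp_ln, E0, ln_exp by apply Hr0. reflexivity. }
  rewrite exp_ln in Hslope by apply Hr0.
  pose proof (profile_immersed a u Hrot Hdiff r0 Hr0) as Hne. fold F in Hne.
  pose proof (HFpos r0 Hr0) as HF. apply Hne.
  apply Rmult_eq_reg_l with (r0 / F r0).
  - rewrite Rmult_0_r, <- Hslope. field. lra.
  - apply Rgt_not_eq, Rdiv_lt_0_compat; lra.
Qed.
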